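(* Let $\Phi$ be a Markovian cocycle on a Polish space $\mathbb{X}$ over a filtered dynamical system $(\Omega,\mathcal{F},P,(\theta_t)_{t\in\mathbb{R}},(\mathcal{F}_s^t)_{s\le t})$, with Markovian semigroup $(P_t)_{t\ge0}$, and let $Y$ be an adapted random periodic path of $\Phi$ of period $\tau>0$. Let $\rho_s$ be the law of $Y(s,\cdot)$, $s\in\mathbb{R}$. Suppose the dynamical system $(\Omega,\mathcal{F},P,(\theta_\tau^n)_{n\ge0})$ is ergodic. Then the following two statements are equivalent: (a) for any $s\in\mathbb{R}$ and $\Gamma\in\mathcal{I}_s^\tau$, for $P$-almost all $\omega\in\Omega$, either $L_s^\omega\cap\Gamma=\emptyset$ or $L_s^\omega\subseteq\Gamma$; (b) the $\tau$-periodic measure $\{\rho_s\}_{s\in\mathbb{R}}$ is PS-ergodic. Moreover, in this case, statement (a) is equivalent to the statement: for any $s\in\mathbb{R}$ and $\Gamma\in\mathcal{I}_s^\tau$, either for $P$-almost all $\omega$, $L_s^\omega\cap\Gamma=\emptyset$, or for $P$-almost all $\omega$, $L_s^\omega\subseteq\Gamma$.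
   Context: Setting. $(\Omega,\mathcal{F},P)$ is a probability space; $\theta:\mathbb{R}\times\Omega\to\Omega$ is jointly measurable with $\theta_0=\mathrm{id}$, $\theta_t\circ\theta_s=\theta_{t+s}$, $\theta_tP=P$. $\Phi:\mathbb{R}^+\times\Omega\times\mathbb{X}\to\mathbb{X}$ is measurable and, almost surely, $\Phi(0,\omega)=\mathrm{id}$, $\Phi(t+s,\omega)=\Phi(t,\theta_s\omega)\circ\Phi(s,\omega)$ for $t,s\ge0$. The $\sigma$-algebras $\mathcal{F}_s^t\subset\mathcal{F}$ $(s\le t)$ satisfy $\theta_u^{-1}\mathcal{F}_s^t=\mathcal{F}_{s+u}^{t+u}$, and $\Phi(t,\cdot)$ is $\mathcal{F}_0^t$-measurable for $t\ge0$. $\Phi$ is Markovian: $\Phi(t,\cdot)x$ is a Markov process with transition probability $P_t(x,\Gamma)=P(\{\omega:\Phi(t,\omega)x\in\Gamma\})$, semigroup $(P_t\varphi)(x)=\int_{\mathbb{X}}P_t(x,dy)\varphi(y)$ on bounded Borel functions, and $P_t^*\rho(\Gamma)=\int_{\mathbb{X}}P_t(x,\Gamma)\rho(dx)$ on probability measures. Random periodic path of period $\tau$: a measurable $Y:\mathbb{R}\times\Omega\to\mathbb{X}$ such that for almost all $\omega$, $\Phi(t,\theta_s\omega)Y(s,\omega)=Y(t+s,\omega)$ and $Y(s+\tau,\omega)=Y(s,\theta_\tau\omega)$ for all $t\ge0,s\in\mathbb{R}$. Adapted: $Y(s,\cdot)$ is measurable with respect to $\mathcal{F}_{-\infty}^s=\bigvee_{r\le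 s}\mathcal{F}_r^s$ for each $s$. The laws $\rho_s(\Gamma)=P(\{\omega:Y(s,\omega)\in\Gamma\})$ form a periodic measure of $(P_t)$ (known result, part of the setting): $P_t^*\rho_s=\rho_{s+t}$ and $\rho_{s+\tau}=\rho_s$ for all $s\in\mathbb{R},t\ge0$. Consequently each $\rho_s$ is invariant for $(P_{k\tau})_{k\in\mathbb{N}}$. Notation. $L_s^\omega=\{Y(s+k\tau,\omega):k\in\mathbb{Z}\}$; $\mathcal{I}_s^\tau=\{\Gamma\in\mathcal{B}(\mathbb{X}):P_\tau I_\Gamma=I_\Gamma,\ \rho_s\text{-a.s.}\}$. Ergodicity. $(\Omega,\mathcal{F},P,(\theta_\tau^n)_{n\ge0})$ is ergodic if $A\in\mathcal{F}$, $\theta_\tau^{-1}A=A$ imply $P(A)\in\{0,1\}$. The $\tau$-periodic measure $\{\rho_s\}$ is PS-ergodic if for each $s\in[0,\tau)$, $\rho_s$ is ergodic as an invariant measure of the discrete semigroup $(P_{k\tau})_{k\in\mathbb{N}}$, i.e. the associated stationary discrete-time canonical dynamical system (shift on path space with finite-dimensional distributions given by initial law $\rho_s$ and transition kernel $P_\tau$) is ergodic; equivalently, $\Gamma\in\mathcal{B}(\mathbb{X})$ and $P_\tau I_\Gamma=I_\Gamma$ $\rho_s$-a.s. imply $\rho_s(\Gamma)\in\{0,1\}$. *)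

(* Defs.v *)
From HB Require Import structures.
From mathcomp Require Import all_boot all_order all_algebra.
From mathcomp Require Import all_classical all_reals all_analysis.

Set Implicit Arguments.
Unset Strict Implicit.
Unset Printing Implicit Defensive.

Import Order.TTheory GRing.Theory Num.Theory.
Import numFieldNormedType.Exports.

Local Open Scope classical_set_scope.
Local Open Scope ring_scope.

Definition completely_metrizable (R : realType) (X : topologicalType) : Prop :=
  exists dist : X -> X -> R,
    [/\ forall x y, dist x y = 0 <-> x = y,
        forall x y, dist x y = dist y x,
        forall x y z, dist x z <= dist x y + dist y z,
        forall x (U : set X),
          nbhs x U <-> exists2 e, 0 < e & [set y | dist x y < e] `<=` U
      & forall u : nat -> X,
          (forall e, 0 < e -> exists N, forall m n,
             (N <= m)%N -> (N <= n)%N -> dist (u m) (u n) < e) ->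
          exists l : X, u @ \oo --> l].

Definition polish (R : realType) (X : topologicalType) : Prop :=
  (exists2 D : set X, countable D & dense D) /\ completely_metrizable R X.

Notation borel X := (g_sigma_algebraType (@open X)).

Section ergodicity.
Context {R : realType}.

(* Only used for f preserving the probability measure mu. *)
Definition ergodic d (T : measurableType d) (mu : set T -> \bar R)
    (f : T -> T) : Prop :=
  forall A, measurable A -> f @^-1` A = A -> mu A = 0%E \/ mu A = 1%E.

Context {d : measure_display} {E : measurableType d}.

Definition path_space :=
  g_sigma_algebraType
    [set (fun x : nat -> E => x n) @^-1` G | n in [set: nat] & G in measurable].

Definition path_shift (x : path_space) : path_space := fun n => x n.+1.

(* The mass that the chain with kernel K and initial law mu gives to
   x_0 \in G 0, ..., x_n \in G n, obtained by conditioning on x_0. *)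
Fixpoint finite_dim (K : E -> set E -> \bar R) (n : nat)
    (mu : set E -> \bar R) (G : nat -> set E) : \bar R :=
  if n is m.+1
  then (\int[mu]_(x in G 0%N) finite_dim K m (K x) (fun i => G i.+1))%E
  else mu (G 0%N).

Definition canonical_law (K : E -> set E -> \bar R) (mu : set E -> \bar R)
    (Q : probability path_space R) : Prop :=
  forall n (G : nat -> set E), (forall i, measurable (G i)) ->
    Q [set x | forall i, (i <= n)%N -> G i (x i)] = finite_dim K n mu G.

(* The law Q on path space is unique, being determined on a pi-system. *)
Definition ergodic_invariant (K : E -> set E -> \bar R)
    (mu : set E -> \bar R) : Prop :=
  exists Q : probability path_space R,
    canonical_law K mu Q /\ ergodic Q path_shift.

(* K t is the transition kernel of the semigroup at time t. *)
Definition PS_ergodic (K : R -> E -> set E -> \bar R) (tau : R)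
    (rho : R -> set E -> \bar R) : Prop :=
  forall s, 0 <= s < tau -> ergodic_invariant (K tau) (rho s).

Definition dual_semigroup (K : R -> E -> set E -> \bar R) (t : R)
    (mu : set E -> \bar R) (G : set E) : \bar R :=
  (\int[mu]_x K t x G)%E.

Definition periodic_measure (K : R -> E -> set E -> \bar R) (tau : R)
    (rho : R -> set E -> \bar R) : Prop :=
  (forall s t G, 0 <= t -> measurable G ->
     dual_semigroup K t (rho s) G = rho (s + t) G) /\
  (forall s G, measurable G -> rho (s + tau) G = rho s G).

Definition markov_semigroup (K : R -> E -> set E -> \bar R) (t : R)
    (phi : E -> R) (x : E) : \bar R :=
  (\int[K t x]_y (phi y)%:E)%E.

Definition invariant_sets (K : R -> E -> set E -> \bar R) (tau : R)
    (mu : set E -> \bar R) : set (set E) :=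
  [set G | measurable G /\
     {ae mu, forall x, markov_semigroup K tau (\1_G) x = (\1_G x)%:E}].

End ergodicity.

Section random_dynamics.
Context {d d' : measure_display} {Omega : measurableType d}
  {E : measurableType d'} {R : realType} (P : probability Omega R).

Record metric_dynamical_system (theta : R -> Omega -> Omega) : Prop := {
  theta_measurable :
    measurable_fun [set: R * Omega] (fun p : R * Omega => theta p.1 p.2);
  theta0 : forall w, theta 0 w = w;
  thetaD : forall t s w, theta (t + s) w = theta t (theta s w);
  theta_preserves : forall t A, measurable A -> P (theta t @^-1` A) = P A }.

(* F s t is only constrained when s <= t. *)
Record filtered_dynamical_system (theta : R -> Omega -> Omega)
    (F : R -> R -> set (set Omega)) : Prop := {
  fds_metric : metric_dynamical_system theta;
  fds_sigma_algebra : forall s t, s <= t -> sigma_algebra [set: Omega] (F s t);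
  fds_measurable : forall s t, s <= t -> F s t `<=` measurable;
  fds_shift : forall u s t, s <= t ->
    [set theta u @^-1` A | A in F s t] = F (s + u) (t + u) }.

(* Phi t is only meaningful, and only ever used, for t >= 0. *)
Record cocycle (theta : R -> Omega -> Omega)
    (Phi : R -> Omega -> E -> E) : Prop := {
  cocycle_measurable :
    measurable_fun [set p : R * (Omega * E) | 0 <= p.1]
      (fun p => Phi p.1 p.2.1 p.2.2);
  cocycle_property : {ae P, forall w,
    (forall x, Phi 0 w x = x) /\
    (forall t s, 0 <= t -> 0 <= s ->
       forall x, Phi (t + s) w x = Phi t (theta s w) (Phi s w x))} }.

Definition transition_prob (Phi : R -> Omega -> E -> E) (t : R) (x : E) :
    set E -> \bar R :=
  pushforward P (fun w => Phi t w x).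

Definition natural_filtration (Z : R -> Omega -> E) (t : R) :
    set (set Omega) :=
  <<s [set Z u @^-1` G | u in [set u | 0 <= u <= t] & G in measurable] >>.

(* P (Z (t + h) \in G | sigma (Z u, 0 <= u <= t)) = K h (Z t) G almost surely,
   tested against the events of the conditioning sigma-algebra. *)
Definition markov_process (K : R -> E -> set E -> \bar R)
    (Z : R -> Omega -> E) : Prop :=
  forall t h, 0 <= t -> 0 <= h ->
  forall (A : set Omega) (G : set E),
    natural_filtration Z t A -> measurable G ->
    P (A `&` Z (t + h) @^-1` G) = (\int[P]_(w in A) K h (Z t w) G)%E.

Record markovian_cocycle (theta : R -> Omega -> Omega)
    (F : R -> R -> set (set Omega)) (Phi : R -> Omega -> E -> E) : Prop := {
  mc_cocycle : cocycle theta Phi;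
  mc_adapted : forall t x G, 0 <= t -> measurable G ->
    F 0 t ((fun w => Phi t w x) @^-1` G);
  mc_markov : forall x,
    markov_process (transition_prob Phi) (fun t w => Phi t w x) }.

Record random_periodic_path (theta : R -> Omega -> Omega)
    (Phi : R -> Omega -> E -> E) (tau : R) (Y : R -> Omega -> E) : Prop := {
  rpp_measurable :
    measurable_fun [set: R * Omega] (fun p : R * Omega => Y p.1 p.2);
  rpp_property : {ae P, forall w,
    (forall t s, 0 <= t -> Phi t (theta s w) (Y s w) = Y (t + s) w) /\
    (forall s, Y (s + tau) w = Y s (theta tau w))} }.

Definition past (F : R -> R -> set (set Omega)) (s : R) : set (set Omega) :=
  <<s \bigcup_(r in [set r | r <= s]) F r s >>.

Definition adapted (F : R -> R -> set (set Omega)) (Y : R -> Omega -> E) :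
    Prop :=
  forall s G, measurable G -> past F s (Y s @^-1` G).

Definition law (Y : R -> Omega -> E) (s : R) : set E -> \bar R :=
  pushforward P (Y s).

Definition periodic_orbit (Y : R -> Omega -> E) (tau s : R) (w : Omega) : set E :=
  [set Y (s + k%:~R * tau) w | k in [set: int]].

End random_dynamics.

(* Main.v *)
Require Import Defs.
From HB Require Import structures.
From mathcomp Require Import all_boot all_order all_algebra.
From mathcomp Require Import all_classical all_reals all_analysis.
From mathcomp Require Import measurable_realfun ring.

(* Both (a) and (b) amount to: for every s, rho_s (G) is 0 or 1 for all G in
   I_s^tau. For (a), Y (s + tau) = Y s o theta_tau makes {Y s in G} invariant
   under theta_tau up to a null set, and conversely all Y (s + k tau) have law
   rho_s, so a G of mass 0 or 1 is a.s. avoided by, or contains, the orbit.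
   For (b), the law of the chain started at x is that of n |-> Phi (n tau) x
   (the one-point Markov property suffices), and the stationary law is its
   mixture over rho_s. If A is a shift-invariant event, h x = Q_x (A) is
   harmonic, and stationarity forces h y = h x for P_tau (x, .)-a.e. y,
   rho_s-a.e. x. Hence Q (A & B) = \int h x Q_x (B) rho_s (dx), first for
   cylinders and then for all B; B = ~A gives h in {0, 1} a.e., so that
   G = {h = 1} is in I_s^tau and Q (A) = rho_s (G). *)

Import Order.TTheory GRing.Theory Num.Theory.
Import numFieldNormedType.Exports.

Local Open Scope classical_set_scope.
Local Open Scope ring_scope.

(** * Integration against mixtures of kernels, and kernels induced by random maps *)

Section mixture.
Context {d1 d2 : measure_display} {T1 : measurableType d1}
  {T2 : measurableType d2} {R : realType}.
Variables (m : {measure set T1 -> \bar R}) (k : R.-ker T1 ~> T2)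
  (n : {measure set T2 -> \bar R}).
Variable D : set T1.
Hypotheses (mD : measurable D)
  (nE : forall B, measurable B -> n B = (\int[m]_(x in D) k x B)%E).

Import HBNNSimple.

(** Monotone convergence along the same simple approximations on both sides; on a simple function
    the claim is [nE] summed over its level sets. *)
Lemma integral_mixture (f : T2 -> \bar R) : (forall y, 0 <= f y)%E ->
  measurable_fun [set: T2] f ->
  (\int[n]_y f y = \int[m]_(x in D) \int[k x]_y f y)%E.
Proof.
move=> f0 mf; pose g := nnsfun_approx measurableT mf.
pose gE i := EFin \o g i.
have mgE i : measurable_fun [set: T2] (gE i) by exact/measurable_EFinP.
have gE0 i y : (0 <= gE i y)%E by rewrite lee_fin.
have ndgE y : {homo gE ^~ y : i j / (i <= j)%O >-> (i <= j)%E}.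
  by move=> *; exact/lefP/nd_nnsfun_approx.
have limgE (mu : {measure set T2 -> \bar R}) :
    (\int[mu]_y f y = limn (fun i => \int[mu]_y gE i y))%E.
  rewrite -monotone_convergence//; apply: eq_integral => y _.
  by apply/esym/cvg_lim => //; exact: cvg_nnsfun_approx.
rewrite limgE; transitivity (limn (fun i => \int[m]_(x in D) \int[k x]_y gE i y)%E).
  apply: congr_lim; apply/funext => i.
  rewrite integralT_nnsfun sintegralE.
  under [RHS]eq_integral do rewrite integralT_nnsfun sintegralE.
  have mk r : measurable_fun D (fun x => k x (g i @^-1` [set r])).
    by apply: measurable_funTS; exact: measurable_kernel.
  rewrite ge0_integral_fsum//; last 2 first.
  - by move=> r; exact: measurable_funeM.
  - by move=> r x _; exact: nnsfun_mulemu_ge0.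
  apply: eq_fsbigr => r _; rewrite nE//.
  (* Pulling out the factor [r] needs [0 <= r]; over a negative [r] the fibre is empty and both
     terms vanish. *)
  have [r0|r0] := leP 0%R r; first by rewrite ge0_integralZl.
  rewrite integral0_eq ?mule0; last by move=> x _; rewrite preimage_nnfun0.
  by rewrite integral0_eq// => x _; rewrite preimage_nnfun0// measure0 mule0.
rewrite -monotone_convergence//.
- by apply: eq_integral => x _; rewrite limgE.
- move=> i; apply: measurable_funTS; apply: measurable_fun_integral_kernel => //.
  exact: measurable_kernel.
- by move=> i x _; exact: integral_ge0.
- by move=> x _ i j ij; apply: ge0_le_integral => // y _; exact: ndgE.
Qed.

End mixture.

(** The Dirac kernel at [Z x] exhibits the pushforward as a mixture. The restriction to [D] serves
    the Markov property, which is tested against events. *)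
Lemma integral_pushforward_mrestr {d1 d2 : measure_display}
    {T1 : measurableType d1} {T2 : measurableType d2} {R : realType}
    (mu : {measure set T1 -> \bar R}) (D : set T1) (mD : measurable D)
    (Z : {mfun T1 >-> T2}) (f : T2 -> \bar R) :
  (forall y, 0 <= f y)%E -> measurable_fun [set: T2] f ->
  (\int[pushforward (mrestr mu mD) Z]_y f y = \int[mu]_(x in D) f (Z x))%E.
Proof.
move=> f0 mf.
rewrite (@integral_mixture _ _ _ _ _ mu (kdirac (measurable_funPT Z)) _ D)//.
  by apply: eq_integral => x _; rewrite integral_dirac// diracT mul1e.
move=> B mB; apply/esym; apply: (@integral_indic _ _ _ mu D mD (Z @^-1` B)).
exact: measurable_funPTI.
Qed.

Section random_map_kernel.
Context {d1 d2 d3 : measure_display} {Omega : measurableType d1}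
  {T1 : measurableType d2} {T2 : measurableType d3} {R : realType}.
Variables (P : probability Omega R) (f : {mfun (Omega * T1)%type >-> T2}).

(** Serves twice: for the time-[tau] map of the cocycle it is the transition kernel, for the sampled
    trajectory it is the path law of the chain started at [x]. *)
Definition random_map_law (x : T1) : set T2 -> \bar R :=
  pushforward P (fun w => f (w, x)).

Let measurable_section x : measurable_fun [set: Omega] (fun w => f (w, x)).
Proof. exact: (measurableT_comp (measurable_funPT f) (measurable_pair2 x)). Qed.

Let law0 x : random_map_law x set0 = 0%E.
Proof. by rewrite /random_map_law measure0. Qed.

Let law_ge0 x A : (0 <= random_map_law x A)%E.
Proof. exact: measure_ge0. Qed.

Let law_sigma_additive x : semi_sigma_additive (random_map_law x).
Proof. exact: measure_semi_sigma_additive. Qed.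

HB.instance Definition _ x := isMeasure.Build _ _ _ (random_map_law x)
  (law0 x) (law_ge0 x) (law_sigma_additive x).

Definition random_map_kernel (x : T1) : {measure set T2 -> \bar R} :=
  random_map_law x.

Let measurable_law U : measurable U ->
  measurable_fun [set: T1] (random_map_kernel ^~ U).
Proof.
move=> mU; have mfU : measurable (f @^-1` U) by exact: measurable_funPTI.
rewrite (_ : (fun _ => _) = P \o ysection (f @^-1` U)).
  exact: measurable_fun_ysection.
by apply/funext => x; rewrite /= ysectionE.
Qed.

HB.instance Definition _ :=
  isKernel.Build _ _ _ _ _ random_map_kernel measurable_law.

Let law_setT x : random_map_kernel x [set: T2] = 1%E.
Proof. exact: probability_setT. Qed.

HB.instance Definition _ := Kernel_isProbability.Build _ _ _ _ _
  random_map_kernel law_setT.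

End random_map_kernel.

Lemma measure_ae_eq {d : measure_display} {T : measurableType d} {R : realType}
    (mu : {measure set T -> \bar R}) A B : measurable A -> measurable B ->
  {ae mu, forall x, A x <-> B x} -> mu A = mu B.
Proof.
move=> mA mB AB; rewrite -[A]setIT -[B]setIT -!integral_indic//.
apply: ge0_ae_eq_integral => //; try by [exact/measurable_EFinP | move=> *; rewrite lee_fin].
apply: filterS AB => x AB _; congr EFin.
by rewrite !indicE; congr (nat_of_bool _)%:R; apply/idP/idP; rewrite !inE => /AB.
Qed.

Section prob_kernel_theory.
Context {d1 d2 : measure_display} {T1 : measurableType d1}
  {T2 : measurableType d2} {R : realType}.
Variables (k : R.-pker T1 ~> T2) (x : T1) (A : set T2).
Hypothesis mA : measurable A.

Lemma prob_kernel_le1 : (k x A <= 1)%E.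
Proof. by rewrite -(@prob_kernel _ _ _ _ _ k x) le_measure// inE. Qed.

Lemma prob_kernel_fin_num : k x A \is a fin_num.
Proof.
by rewrite ge0_fin_numE// (le_lt_trans prob_kernel_le1)// ltry.
Qed.

Lemma prob_kernel_setC : (k x (~` A) = 1 - k x A)%E.
Proof.
have kT : (k x setT < +oo)%E by rewrite prob_kernel ltry.
by rewrite -setTD measureD// setTI; congr (_ - _)%E; exact: prob_kernel.
Qed.

End prob_kernel_theory.

(** * Measure-preserving maps, and ergodicity modulo null sets *)

Section measure_preserving.
Context {d : measure_display} {T : measurableType d} {R : realType}.
Variables (mu : {measure set T -> \bar R}) (f : T -> T).
Hypotheses (mf : measurable_fun [set: T] f)
  (fmu : forall A, measurable A -> mu (f @^-1` A) = mu A).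

Lemma measurable_iter n : measurable_fun [set: T] (iter n f).
Proof.
by elim: n => [|n IHn]; [exact: measurable_id|exact: (measurableT_comp mf IHn)].
Qed.

Lemma measure_preserving_iter n A : measurable A ->
  mu (iter n f @^-1` A) = mu A.
Proof.
move=> mA; elim: n => // n IHn.
rewrite (_ : iter n.+1 f = iter n f \o f); last first.
  by apply/funext => x; rewrite iterSr.
rewrite comp_preimage fmu// -[X in measurable X]setTI.
exact: measurable_iter.
Qed.

Lemma ae_iter n (p : set T) : {ae mu, forall x, p x} ->
  {ae mu, forall x, p (iter n f x)}.
Proof.
move=> [N [mN N0 pN]]; exists (iter n f @^-1` N); split.
- by rewrite -[X in measurable X]setTI; exact: measurable_iter.
- by rewrite measure_preserving_iter.
- by move=> x; exact: pN.
Qed.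

End measure_preserving.

(* The set of points whose orbit visits A infinitely often is strictly
   invariant. *)
Lemma ergodic_ae {d : measure_display} {T : measurableType d} {R : realType}
    (mu : probability T R) (f : T -> T) A :
  measurable_fun [set: T] f ->
  (forall B, measurable B -> mu (f @^-1` B) = mu B) -> ergodic mu f ->
  measurable A -> {ae mu, forall x, A x <-> A (f x)} ->
  mu A = 0%E \/ mu A = 1%E.
Proof.
move=> mf fmu ergf mA AfA.
have {AfA} iterA : {ae mu, forall x n, A x <-> A (iter n f x)}.
  apply: filterS (ae_foralln (fun n => ae_iter mu f mf fmu n _ AfA)) => x xA n.
  by elim: n => // n IHn; exact: iff_trans IHn (xA n).
pose B := lim_sup_set (fun n => iter n f @^-1` A).
have mB : measurable B.
  apply: bigcapT_measurable => n; apply: bigcup_measurable => k _.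
  by rewrite -[X in measurable X]setTI; exact: measurable_iter.
have fB : f @^-1` B = B.
  apply/seteqP; split => x Bx n _.
    by have [k /= nk Ak] := Bx n I; exists k.+1; [exact: leqW|rewrite /preimage /= -iterS iterSr].
  have [[|k] //= nk Ak] := Bx n.+1 I.
  by exists k => //; rewrite /= -iterSr.
(* Almost everywhere, membership in [A] is constant along the whole orbit, so visiting [A]
   infinitely often amounts to starting in [A]. *)
suff -> : mu A = mu B by exact: ergf.
apply: measure_ae_eq => //; apply: filterS iterA => x xA.
split=> [Ax n _|/(_ 0%N I)[n _ /xA]//].
by exists n => /=; [exact: leqnn|exact/xA].
Qed.

(** * Path space and its generating pi-system of cylinders *)

Section path_space_theory.
Context {d : measure_display} {E : measurableType d}.

(** Coordinates 0 to [n] inclusive are constrained, so [cylinder 0] restricts the starting point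
    alone. The shape is literally that of the events in [canonical_law]. *)
Definition cylinder (n : nat) (G : nat -> set E) : set (@path_space d E) :=
  [set p | forall i, (i <= n)%N -> G i (p i)].

Definition cylinders : set (set (@path_space d E)) :=
  [set C | exists n G, (forall i, measurable (G i)) /\ C = cylinder n G].

Lemma measurable_coordinate i :
  measurable_fun [set: @path_space d E] (fun p => p i).
Proof.
move=> _ B mB; rewrite setTI; apply: sub_sigma_algebra.
by exists i => //; exists B.
Qed.

Lemma measurable_cylinder n G : (forall i, measurable (G i)) ->
  measurable (cylinder n G).
Proof.
move=> mG; rewrite (_ : cylinder n G =
    \bigcap_(i in [set i | (i <= n)%N]) ((fun p : @path_space d E => p i) @^-1` G i)).
  apply: bigcap_measurable => [|i _]; [by exists 0%N|rewrite -[X in measurable X]setTI].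
  exact: measurable_coordinate.
by apply/seteqP; split.
Qed.

Lemma cylinderT n : cylinder n (fun _ => setT) = setT.
Proof. by apply/seteqP; split. Qed.

Lemma cylindersT : cylinders setT.
Proof. by exists 0%N, (fun _ => setT); split=> //; rewrite cylinderT. Qed.

Lemma setI_closed_cylinders : setI_closed cylinders.
Proof.
move=> _ _ [n [G [mG ->]]] [m [H [mH ->]]].
exists (maxn n m), (fun i => (if (i <= n)%N then G i else setT) `&`
                             (if (i <= m)%N then H i else setT)); split.
  by move=> i; apply: measurableI; case: ifP.
apply/seteqP; split=> [p [Gp Hp] i _|p GHp].
  by split; case: ifP => // /[dup]; [move=> _ /Gp|move=> _ /Hp].
split=> i ile.
  by have [] := GHp i (leq_trans ile (leq_maxl _ _)); rewrite ile.
by have [] := GHp i (leq_trans ile (leq_maxr _ _)); rewrite ile.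
Qed.

Lemma measurable_cylinders :
  @measurable _ (@path_space d E) = <<s cylinders >>.
Proof.
apply/seteqP; split.
  apply: smallest_sub; first exact: smallest_sigma_algebra.
  move=> _ [n _ [G mG <-]]; apply: sub_sigma_algebra.
  exists n, (fun i => if i == n then G else setT); split.
    by move=> i; case: ifP.
  apply/seteqP; split=> [p Gp i _|p /(_ n (leqnn _))]; last by rewrite eqxx.
  by case: eqP => // ->.
apply: smallest_sub; first exact: sigma_algebra_measurable.
by move=> _ [n [G [mG ->]]]; exact: measurable_cylinder.
Qed.

(** The whole space is itself a cylinder, so the total masses agree and finiteness of [m1] is enough
    for uniqueness on the pi-system. *)
Lemma eq_path_measure {R : realType} (m1 m2 : {measure set (@path_space d E) -> \bar R}) :
  (m1 setT < +oo)%E ->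
  (forall n G, (forall i, measurable (G i)) ->
    m1 (cylinder n G) = m2 (cylinder n G)) ->
  forall A, measurable A -> m1 A = m2 A.
Proof.
move=> m1T m12 A mA.
apply: (measure_unique cylinders (fun _ => setT)) => //.
- exact: measurable_cylinders.
- exact: setI_closed_cylinders.
- by move=> _; exact: cylindersT.
- by rewrite bigcup_const.
- by move=> _ [n [G [mG ->]]]; exact: m12.
Qed.

Lemma measurable_into_path_space {d'} {T : measurableType d'}
    (f : T -> @path_space d E) :
  (forall n, measurable_fun [set: T] (fun t => f t n)) ->
  measurable_fun [set: T] f.
Proof.
move=> mf; apply: (@measurability _ _ T (@path_space d E) setT f
  [set (fun p : nat -> E => p n) @^-1` G |
    n in [set: nat] & G in measurable]) => //.
by move=> _ [_ [n _ [G mG <-]] <-]; exact: (mf n).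
Qed.

Lemma measurable_path_shift :
  measurable_fun [set: @path_space d E] (@path_shift d E).
Proof.
by apply: measurable_into_path_space => n; exact: measurable_coordinate.
Qed.

HB.instance Definition _ := isMeasurableFun.Build _ _ _ _
  (@path_shift d E) measurable_path_shift.

Lemma cylinder0 G : cylinder 0 G = cylinder 0 (fun _ => G 0%N).
Proof.
by apply/seteqP; split=> p Gp i; rewrite leqn0 => /eqP->; exact: Gp.
Qed.

Lemma cylinderS n G : cylinder n.+1 G =
  cylinder 0 G `&` path_shift @^-1` cylinder n (fun i => G i.+1).
Proof.
apply/seteqP; split=> [p Gp|p [Gp0 Gp] [|i] ile]; last 2 first.
- exact: Gp0.
- exact: Gp.
by split=> [i|i]; [rewrite leqn0 => /eqP->|]; move=> *; exact: Gp.
Qed.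

End path_space_theory.

(** * Path laws of a Markov chain with a fixed starting point *)

Section markov_chain.
Context {d : measure_display} {E : measurableType d} {R : realType}.
Variable K : R.-pker E ~> E.

(** The finite-dimensional probabilities as a function of the starting point, whereas [finite_dim]
    recurses on the initial measure; in this form they can be integrated against any law. *)
Fixpoint path_prob (n : nat) (G : nat -> set E) (x : E) : \bar R :=
  ((\1_(G 0%N) x)%:E *
   if n is m.+1 then \int[K x]_y path_prob m (fun i => G i.+1) y else 1)%E.

Lemma path_prob_ge0 n G x : (0 <= path_prob n G x)%E.
Proof.
elim: n => [|n IHn] in G x *; first by rewrite /= mule1 lee_fin.
by rewrite mule_ge0 ?lee_fin//; exact: integral_ge0.
Qed.

Lemma measurable_path_prob n G : (forall i, measurable (G i)) ->
  measurable_fun [set: E] (path_prob n G).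
Proof.
elim: n => [|n IHn] in G * => mG.
  apply: emeasurable_funM => //.
  exact/measurable_EFinP.
apply: emeasurable_funM; first exact/measurable_EFinP.
apply: measurable_fun_integral_kernel.
- exact: measurable_kernel.
- by move=> z; exact: path_prob_ge0.
- exact: IHn.
Qed.

Lemma finite_dimE n (mu : {measure set E -> \bar R}) G :
  (forall i, measurable (G i)) ->
  finite_dim (fun x => K x) n mu G = (\int[mu]_x path_prob n G x)%E.
Proof.
elim: n => [|n IHn] in mu G * => mG /=.
  by under eq_integral do rewrite mule1; rewrite integral_indic// setIT.
rewrite integral_mkcond epatch_indic; apply: eq_integral => x _ /=.
by rewrite muleC IHn.
Qed.

Section path_law.
Variable Q : R.-pker E ~> (@path_space d E).
Hypothesis QE : forall x n G, (forall i, measurable (G i)) ->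
  Q x (cylinder n G) = path_prob n G x.

(** The Markov property at time one. Both sides are measures in [B], so cylinders suffice. *)
Lemma path_law_shift x B : measurable B ->
  Q x (path_shift @^-1` B) = (\int[K x]_y Q y B)%E.
Proof.
move: B; apply: (@eq_path_measure _ _ _ (pushforward (Q x) path_shift)
  (mkcomp_noparam K Q x)) => /=.
  by rewrite /pushforward preimage_setT prob_kernel ltry.
move=> n G mG; rewrite /pushforward /mkcomp_noparam /kcomp_noparam.
under [RHS]eq_integral do rewrite QE//.
(* The preimage of a cylinder under the shift is a longer cylinder with time 0 left free. *)
have := QE x n.+1 (fun i => if i is j.+1 then G j else setT).
rewrite cylinderS /= indicT mul1e => <-; last by case.
by congr (Q x _); apply/seteqP; split=> [p Gp|p []//]; split=> // -[].
Qed.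

(** Under [Q x] the path starts in [G] with probability 1 or 0, according to whether [x] lies in
    [G]. *)
Lemma path_law_start x G B : measurable G -> measurable B ->
  Q x (cylinder 0 (fun _ => G) `&` B) = ((\1_G x)%:E * Q x B)%E.
Proof.
move=> mG mB.
have mC H : measurable H -> measurable (@cylinder d E 0 (fun _ => H)).
  by move=> mH; exact: measurable_cylinder.
have QC H : measurable H -> Q x (cylinder 0 (fun _ => H)) = (\1_H x)%:E.
  by move=> mH; rewrite QE//= mule1.
have [xG|xG] := pselect (G x).
  rewrite indicE mem_set// mul1e; apply: measure_ae_eq => //.
    by apply: measurableI => //; exact: mC.
  (* Singletons need not be measurable in [E], so the exceptional set consists of the paths starting
     outside [G], not of those starting away from [x]. *)
  exists (cylinder 0 (fun _ => ~` G)); split.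
  - by apply: mC; exact: measurableC.
  - rewrite QC; last exact: measurableC.
    by rewrite indicE memNset.
  - move=> p /= Cp i; rewrite leqn0 => /eqP-> Gp0.
    by apply: Cp; split=> [[]//|Bp]; split=> // j; rewrite leqn0 => /eqP->.
rewrite indicE memNset// mul0e; apply: (@subset_measure0 _ _ _ _ _ (cylinder 0 (fun _ => G))) => //.
- by apply: measurableI => //; exact: mC.
- exact: mC.
- by have := QC G mG; rewrite indicE memNset.
Qed.

End path_law.
End markov_chain.

Lemma adde_cancelr {R : realType} (z x y : \bar R) : z \is a fin_num ->
  (x + z = y + z -> x = y)%E.
Proof. by move=> fz xy; rewrite -(addeK x fz) xy addeK. Qed.

(** * Invariant measures: from ergodic path systems to trivial invariant sets, and harmonic
    functions *)

Section invariant_measure.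
Context {d : measure_display} {E : measurableType d} {R : realType}.
Variables (K : R.-pker E ~> E) (mu : probability E R).
Hypothesis muK : forall G, measurable G -> (\int[mu]_x K x G)%E = mu G.

(** Invariance says that [mu] is the mixture of [K] over [mu] itself. *)
Lemma invariant_integral (f : E -> \bar R) : (forall y, 0 <= f y)%E ->
  measurable_fun [set: E] f -> (\int[mu]_x \int[K x]_y f y = \int[mu]_y f y)%E.
Proof.
move=> f0 mf; apply/esym/integral_mixture => // B mB.
by rewrite muK.
Qed.

(** For a null set [N], the nonnegative function [K x N] integrates to [mu N = 0], hence vanishes
    almost everywhere. *)
Lemma ae_kernel (p : set E) : {ae mu, forall x, p x} ->
  {ae mu, forall x, {ae K x, forall y, p y}}.
Proof.
move=> [N [mN N0 pN]].
have /ae_eq_integral_abs : measurable_fun [set: E] (fun x => K x N).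
  exact: measurable_kernel.
move=> /(_ mu measurableT)[+ _].
under eq_integral do rewrite gee0_abs//.
rewrite muK// => /(_ N0); apply: filterS => x /(_ I) KN0.
by exists N; split.
Qed.

Definition trivial_invariant_sets := forall G, measurable G ->
  {ae mu, forall x, K x G = (\1_G x)%:E} -> mu G = 0%E \/ mu G = 1%E.

Section ergodic_trivial.
Variable Q : probability (@path_space d E) R.
Hypothesis QK : canonical_law (fun x => K x) mu Q.

(** On cylinders, the shift frees the coordinate at time 0, and invariance of [mu] integrates that
    coordinate out. *)
Lemma canonical_law_stationary B : measurable B -> Q (path_shift @^-1` B) = Q B.
Proof.
move: B; apply: (@eq_path_measure _ _ _ (pushforward Q path_shift)) => /=.
  by rewrite /pushforward preimage_setT probability_setT ltry.
move=> n G mG; rewrite /pushforward QK// finite_dimE//.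
rewrite -invariant_integral; last 2 first.
- by move=> x; exact: path_prob_ge0.
- exact: measurable_path_prob.
have := QK n.+1 (fun i => if i is j.+1 then G j else setT).
rewrite finite_dimE; last by case.
rewrite (_ : [set x | _] = path_shift @^-1` cylinder n G); last first.
  by apply/seteqP; split=> [p Gp i ile|p Gp [|i] ile //]; [exact: (Gp i.+1)|exact: Gp].
move=> ->; last by case.
by apply: eq_integral => x _ /=; rewrite indicT mul1e.
Qed.

(** The chain almost surely does not cross between [G] and its complement in its first step, so the
    event of starting in [G] is shift-invariant modulo a null set. *)
Lemma ergodic_trivial_invariant_sets :
  ergodic Q path_shift -> trivial_invariant_sets.
Proof.
move=> ergQ G mG KG; pose C := cylinder 0 (fun _ : nat => G).
have mC : measurable C by exact: measurable_cylinder.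
have -> : mu G = Q C by rewrite QK.
apply: (@ergodic_ae _ _ _ Q (@path_shift d E) C) => //.
- exact: canonical_law_stationary.
(* Leaving [H] at the first step has probability the integral of [K x (~H)] over [H], which is zero.
   Taking [H] to be [G] and then its complement covers both directions of crossing. *)
have jump0 H : measurable H -> {ae mu, forall x, K x H = (\1_H x)%:E} ->
    Q.-negligible (cylinder 1 (fun i => if i == 0%N then H else ~` H)).
  move=> mH KH; have mH' i : measurable (if i == 0%N then H else ~` H).
    by case: ifP => // _; exact: measurableC.
  apply/negligibleP; first exact: measurable_cylinder.
  apply: etrans (QK 1%N _ mH') _; rewrite /= -(integral0 mu H).
  apply: ge0_ae_eq_integral => //.
    by apply: measurable_funTS; apply: measurable_kernel; exact: measurableC.
  apply: filterS KH => x KHx Hx.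
  by rewrite /= prob_kernel_setC// KHx indicE mem_set//= subee.
have KGC : {ae mu, forall x, K x (~` G) = (\1_(~` G) x)%:E}.
  apply: filterS KG => x KGx; rewrite prob_kernel_setC// KGx.
  by rewrite !indicE in_setC; case: (x \in G); rewrite -EFinB ?subrr ?subr0.
apply: negligibleS (negligibleU (jump0 G mG KG) (jump0 _ (measurableC mG) KGC)).
have C0 (q : @path_space d E) : C q <-> G (q 0%N).
  by split=> [|Gq i]; [exact|rewrite leqn0 => /eqP->].
move=> p /= /not_andP[] /not_implyP[/C0 Cp nCp]; [left|right] => -[|[|//]] _ /=.
- exact: Cp.
- by move=> Gp1; apply/nCp/C0.
- by move=> Gp0; apply/nCp/C0.
- by apply; exact: Cp.
Qed.

End ergodic_trivial.

(* Invariance of mu gives the variance integral \int\int (h y - h x)^2 the value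
   \int h^2 - \int h^2 = 0. *)
Lemma harmonic_ae_constant (h : E -> R) : measurable_fun [set: E] h ->
  (forall x, 0 <= h x <= 1) ->
  (forall x, \int[K x]_y (h y)%:E = (h x)%:E)%E ->
  {ae mu, forall x, {ae K x, forall y, h y = h x}}.
Proof.
move=> mh h01 Kh; have h0 x : 0 <= h x by case/andP: (h01 x).
pose V x := (\int[K x]_y ((h y - h x) ^+ 2)%:E)%E.
pose S x := (\int[K x]_y (h y ^+ 2)%:E)%E.
have mh2 : measurable_fun [set: E] (fun y => (h y ^+ 2)%:E).
  by apply/measurable_EFinP; exact: measurable_funX.
have mV x : measurable_fun [set: E] (fun y => ((h y - h x) ^+ 2)%:E).
  by apply/measurable_EFinP/measurable_funX; exact: measurable_funB.
have S0 x : (0 <= S x)%E.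
  by apply: integral_ge0 => y _; rewrite lee_fin sqr_ge0.
have mS : measurable_fun [set: E] S.
  apply: measurable_fun_integral_kernel => //; first exact: measurable_kernel.
  by move=> z; rewrite lee_fin sqr_ge0.
have V0 x : (0 <= V x)%E.
  by apply: integral_ge0 => y _; rewrite lee_fin sqr_ge0.
have VS x : (V x + (h x ^+ 2)%:E = S x)%E.
  (* The expanded square, with the cross term moved to the left so that all integrands are
     nonnegative; harmonicity evaluates that cross term. *)
  have : (V x + (2 * h x * h x)%:E = S x + (h x ^+ 2)%:E)%E.
    have -> : ((h x ^+ 2)%:E = \int[K x]_y (h x ^+ 2)%:E)%E.
      by rewrite integral_cst// prob_kernel mule1.
    have -> : ((2 * h x * h x)%:E = \int[K x]_y (2 * h x * h y)%:E)%E.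
      under eq_integral do rewrite EFinM.
      rewrite ge0_integralZl//; first by rewrite Kh -EFinM.
      - exact/measurable_EFinP.
      - by move=> y _; rewrite lee_fin.
      - by rewrite lee_fin mulr_ge0.
    rewrite -!ge0_integralD//.
    - by apply: eq_integral => y _; rewrite -!EFinD; congr EFin; ring.
    - by move=> y _; rewrite lee_fin sqr_ge0.
    - by move=> y _; rewrite lee_fin sqr_ge0.
    - by move=> y _; rewrite lee_fin sqr_ge0.
    - by move=> y _; rewrite lee_fin !mulr_ge0.
    - by apply/measurable_EFinP; exact: measurable_funM.
  have -> : 2 * h x * h x = h x ^+ 2 + h x ^+ 2 by ring.
  by rewrite EFinD addeA => /adde_cancelr; apply.
(* In [V] the point [x] enters both the kernel and the integrand; this form yields measurability in
   [x]. *)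
have VE : V = (fun x => S x - (h x ^+ 2)%:E)%E.
  by apply/funext => x; rewrite -VS addeK.
have mV' : measurable_fun [set: E] V.
  by rewrite VE; exact: emeasurable_funB.
have : (\int[mu]_x V x = 0)%E.
  have : (\int[mu]_x V x + \int[mu]_x (h x ^+ 2)%:E = 0 + \int[mu]_x (h x ^+ 2)%:E)%E.
    rewrite -ge0_integralD//; last by move=> x _; rewrite lee_fin sqr_ge0.
    under eq_integral do rewrite VS.
    rewrite add0e invariant_integral//.
    by move=> x; rewrite lee_fin sqr_ge0.
  move=> /adde_cancelr; apply; rewrite ge0_fin_numE; last first.
    by apply: integral_ge0 => x _; rewrite lee_fin sqr_ge0.
  apply: (@le_lt_trans _ _ (\int[mu]_x 1)%E).
    apply: ge0_le_integral => //; first by move=> x _; rewrite lee_fin sqr_ge0.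
    by move=> x _; have /andP[? ?] := h01 x; rewrite lee_fin expr_le1.
  by rewrite integral_cst// mul1e (le_lt_trans (probability_le1 mu measurableT)) ?ltry.
(* A nonnegative function with zero integral vanishes almost everywhere: applied first in [x] to
   [V], then in [y] to the squared difference. *)
under eq_integral do rewrite -[V _]gee0_abs//.
move=> /(ae_eq_integral_abs mu measurableT mV'); apply: filterS => x /(_ I).
rewrite /V; under eq_integral do rewrite -[_%:E]gee0_abs ?lee_fin ?sqr_ge0//.
move=> /(ae_eq_integral_abs (K x) measurableT (mV x)); apply: filterS => y /(_ I) [].
by move/eqP; rewrite sqrf_eq0 subr_eq0 => /eqP.
Qed.

End invariant_measure.

(** * From trivial invariant sets to ergodicity of the path system *)

Section trivial_ergodic.
Context {d : measure_display} {E : measurableType d} {R : realType}.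
Variables (K : R.-pker E ~> E) (mu : probability E R).
Hypothesis muK : forall G, measurable G -> (\int[mu]_x K x G)%E = mu G.
Variable Q : R.-pker E ~> (@path_space d E).
Hypothesis QE : forall x n G, (forall i, measurable (G i)) ->
  Q x (cylinder n G) = path_prob K n G x.
Variable Qmu : probability (@path_space d E) R.
Hypothesis QmuE : forall B, measurable B -> Qmu B = (\int[mu]_x Q x B)%E.

Lemma mixture_canonical_law : canonical_law (fun x => K x) mu Qmu.
Proof.
move=> n G mG; rewrite finite_dimE// QmuE; last exact: measurable_cylinder.
by apply: eq_integral => x _; rewrite QE.
Qed.

Section invariant_event.
Variable A : set (@path_space d E).
Hypotheses (mA : measurable A) (shiftA : path_shift @^-1` A = A).

Let h x := fine (Q x A).

Let QA x : Q x A = (h x)%:E.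
Proof. by rewrite /h fineK//; exact: prob_kernel_fin_num. Qed.

Let h01 x : 0 <= h x <= 1.
Proof. by rewrite -!lee_fin -QA measure_ge0/= prob_kernel_le1. Qed.

Let mh : measurable_fun [set: E] h.
Proof.
by apply: measurableT_comp => //; exact: measurable_kernel.
Qed.

Let harmonic x : (\int[K x]_y (h y)%:E = (h x)%:E)%E.
Proof.
rewrite -QA -shiftA (path_law_shift K Q QE)//.
by apply: eq_integral => y _; rewrite QA.
Qed.

Let constant := harmonic_ae_constant K mu muK h mh h01 harmonic.

Let mQ B : measurable B -> measurable_fun [set: E] (fun x => Q x B).
Proof. by move=> mB; exact: measurable_kernel. Qed.

Let mhQ B : measurable B -> measurable_fun [set: E] (fun x => (h x)%:E * Q x B)%E.
Proof.
by move=> mB; apply: emeasurable_funM; [exact/measurable_EFinP|exact: mQ].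
Qed.

Let hQ0 x B : (0 <= (h x)%:E * Q x B)%E.
Proof. by rewrite mule_ge0// lee_fin; case/andP: (h01 x). Qed.

(** Conditional independence of [A] and the cylinder given the start. After one step the same
    statement holds at [y] with factor [h y], and [h y = h x] for almost every [y]. *)
Lemma invariant_event_cylinder n G : (forall i, measurable (G i)) ->
  {ae mu, forall x, Q x (A `&` cylinder n G) = ((h x)%:E * Q x (cylinder n G))%E}.
Proof.
elim: n => [|n IHn] in G * => mG.
  apply: aeW => x; rewrite setIC QE//=.
  by rewrite cylinder0 (path_law_start K Q QE)// mule1 QA muleC.
have mG' i : measurable (G i.+1) by [].
have mC := measurable_cylinder n (fun i => G i.+1) mG'.
(* The induction hypothesis holds only [mu]-a.e.; invariance transfers it to [K x]-a.e.
   successor. *)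
have := ae_kernel K mu muK _ (IHn _ mG').
apply: filterS2 constant => x hx IHx.
(* Replacing [A] by its shift preimage merges it with the constraint on the shifted path. *)
rewrite QE// cylinderS cylinder0 -{1}shiftA setICA -preimage_setI.
rewrite (path_law_start K Q QE)//; last first.
  by rewrite -[X in measurable X]setTI; apply: measurable_path_shift => //; exact: measurableI.
rewrite (path_law_shift K Q QE)/=; last exact: measurableI.
rewrite muleCA; congr (_ * _)%E.
have -> : (\int[K x]_y Q y (A `&` cylinder n (fun i => G i.+1)) =
  \int[K x]_y ((h x)%:E * path_prob K n (fun i => G i.+1) y))%E.
  apply: ge0_ae_eq_integral => //.
  - by apply: mQ; exact: measurableI.
  - by apply: measurable_funeM; exact: measurable_path_prob.
  - move=> y _; rewrite mule_ge0 ?path_prob_ge0// lee_fin.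
    by case/andP: (h01 x).
  by apply: filterS2 hx IHx => y <- IHy _; rewrite IHy QE.
rewrite ge0_integralZl//; first exact: measurable_path_prob.
- by move=> y _; exact: path_prob_ge0.
- by rewrite lee_fin; case/andP: (h01 x).
Qed.

Lemma invariant_event_density B : measurable B ->
  Qmu (A `&` B) = (\int[mu]_x ((h x)%:E * Q x B))%E.
Proof.
rewrite measurable_cylinders; move: B.
apply: (@dynkin_induction _ (@path_space d E) cylinders (fun B =>
  Qmu (A `&` B) = \int[mu]_x ((h x)%:E * Q x B))%E) => [||||S mS IHS|F mF tF IHF].
- exact: measurable_cylinders.
- exact: setI_closed_cylinders.
- rewrite setIT QmuE//; apply: eq_integral => x _.
  by rewrite prob_kernel mule1 QA.
- move=> _ [n [G [mG ->]]]; have mC := measurable_cylinder n G mG.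
  rewrite QmuE; last exact: measurableI.
  apply: ge0_ae_eq_integral => //.
  + by apply: mQ; exact: measurableI.
  + exact: mhQ.
  + by apply: filterS (invariant_event_cylinder n G mG) => x + _.
(* Complements are handled by adding the finite mass of [A] and [S] to both sides, which avoids
   subtracting integrals. *)
- have : (Qmu (A `&` ~` S) + Qmu (A `&` S) =
      \int[mu]_x ((h x)%:E * Q x (~` S)) + Qmu (A `&` S))%E.
    have -> : (Qmu (A `&` ~` S) + Qmu (A `&` S) = Qmu A)%E.
      rewrite -measureU.
      - by congr (Qmu _); rewrite -setIUr setUC setUv setIT.
      - by apply: measurableI => //; exact: measurableC.
      - exact: measurableI.
      - by rewrite setIACA setICl setI0.
    rewrite IHS QmuE// -ge0_integralD//; last 2 first.
    + by apply: mhQ; exact: measurableC.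
    + exact: mhQ.
    apply: eq_integral => x _.
    rewrite -ge0_muleDr// prob_kernel_setC// subeK ?mule1 ?QA//.
    exact: prob_kernel_fin_num.
  by move=> /adde_cancelr; apply; apply: fin_num_measure; exact: measurableI.
- have mUF : measurable (\bigcup_k F k) by exact: bigcupT_measurable.
  have mAF k : measurable (A `&` F k) by exact: measurableI.
  rewrite setI_bigcupr measure_semi_bigcup//; last 2 first.
  + apply/trivIsetP => i j _ _ ij; rewrite setIACA.
    by move/trivIsetP : tF => ->//; rewrite setI0.
  + exact: bigcupT_measurable.
  transitivity (\sum_(k <oo) \int[mu]_x ((h x)%:E * Q x (F k)))%E.
    by apply: eq_eseriesr => k _; exact: IHF.
  rewrite -integral_nneseries//; last by move=> n; exact: mhQ.
  apply: eq_integral => x _; rewrite nneseriesZl//.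
  by rewrite measure_semi_bigcup.
Qed.

Lemma invariant_event_01 : trivial_invariant_sets K mu ->
  Qmu A = 0%E \/ Qmu A = 1%E.
Proof.
move=> triv; pose G := h @^-1` [set 1].
have mG : measurable G by rewrite -[G]setTI; exact: mh.
have KG : {ae mu, forall x, K x G = (\1_G x)%:E}.
  (* As [h] keeps its value over one step, almost every successor of [x] lies in [G] exactly when
     [x] does. *)
  apply: filterS constant => x hx; rewrite indicE.
  have [xG|xG] := boolP (x \in G); rewrite /=.
    rewrite -(@prob_kernel _ _ _ _ _ K x); apply: measure_ae_eq => //.
    by apply: filterS hx => y hy; split=> // _; exact: etrans hy (set_mem xG).
  apply: etrans (measure0 (K x)); apply: measure_ae_eq => //.
  apply: filterS hx => y hy; split=> // Gy.
  by move: xG; rewrite notin_setE; case; exact: etrans (esym hy) Gy.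
have hG : {ae mu, forall x, Q x A = (\1_G x)%:E}.
  have mCA : measurable (~` A) by exact: measurableC.
  (* The left side is the mass of the empty set, so the nonnegative integrand [h x * (1 - h x)]
     vanishes almost everywhere. *)
  have := invariant_event_density (~` A) mCA.
  rewrite setICr measure0 => /esym.
  under eq_integral do rewrite -[(_ * _)%E]gee0_abs//.
  move=> /(ae_eq_integral_abs mu measurableT (mhQ _ mCA)); apply: filterS => x /(_ I).
  rewrite prob_kernel_setC// QA indicE => -[] /eqP.
  rewrite mulf_eq0 subr_eq0 => /orP[/eqP hx|/eqP hx].
    by rewrite hx memNset// /G/= hx => /esym/eqP; rewrite oner_eq0.
  by rewrite mem_set -?hx// /G/= -hx.
suff -> : Qmu A = mu G by exact: triv.
rewrite QmuE// -[G]setIT -integral_indic//.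
apply: ge0_ae_eq_integral => //.
- exact: mQ.
- exact/measurable_EFinP.
- by apply: filterS hG => x.
Qed.

End invariant_event.

Lemma trivial_invariant_sets_ergodic :
  trivial_invariant_sets K mu -> ergodic Qmu path_shift.
Proof. by move=> triv A mA shiftA; exact: invariant_event_01. Qed.

End trivial_ergodic.

(** * From the one-step Markov property to finite-dimensional laws *)

Section markov_process_path.
Context {d d' : measure_display} {Omega : measurableType d}
  {E : measurableType d'} {R : realType}.
Variables (P : probability Omega R) (K : R.-pker E ~> E)
  (kern : R -> E -> set E -> \bar R) (tau : R) (Z : R -> Omega -> E).
Hypotheses (tau0 : 0 <= tau) (kernE : kern tau = (fun x => K x))
  (mZ : forall t, 0 <= t -> measurable_fun [set: Omega] (Z t))
  (markovZ : markov_process P kern Z).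

Lemma natural_filtration_measurable t A :
  natural_filtration Z t A -> measurable A.
Proof.
move: A; apply: smallest_sub; first exact: sigma_algebra_measurable.
move=> _ [u /= /andP[u0 _] [G mG <-]].
by rewrite -[X in measurable X]setTI; exact: mZ.
Qed.

Lemma natural_filtration_le s t : s <= t ->
  natural_filtration Z s `<=` natural_filtration Z t.
Proof.
move=> st; apply: sub_smallest2r; first exact: smallest_sigma_algebra.
move=> _ [u /= /andP[u0 us] [G mG <-]]; exists u; last by exists G.
by rewrite /= u0 (le_trans us).
Qed.

Lemma natural_filtration_preimage t A G : 0 <= t -> measurable G ->
  natural_filtration Z t A -> natural_filtration Z t (A `&` Z t @^-1` G).
Proof.
move=> t0 mG FA; apply: (@measurableI _ (g_sigma_algebraType
  [set Z u @^-1` G | u in [set u | 0 <= u <= t] & G in measurable])) => //.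
by apply: sub_sigma_algebra; exists t; rewrite /= ?t0 ?lexx//; exists G.
Qed.

(** The starting time [m] and the past event [A] vary in the induction: the constraint at time [m]
    is absorbed into the past before moving to [m.+1]. *)
Lemma markov_process_path n m G A : (forall i, measurable (G i)) ->
  natural_filtration Z (m%:R * tau) A ->
  (P (A `&` [set w | forall i, (i <= n)%N -> G i (Z ((m + i)%:R * tau) w)]) =
   \int[P]_(w in A) path_prob K n G (Z (m%:R * tau) w))%E.
Proof.
elim: n => [|n IHn] in m G A * => mG FA.
  have mA := natural_filtration_measurable _ _ FA.
  have t0 : 0 <= m%:R * tau by rewrite mulr_ge0.
  under eq_integral do rewrite /= mule1.
  rewrite setIC; apply: etrans (esym (@integral_indic _ _ _ P A mA _ _)).
  - congr (P (_ `&` A)); apply/seteqP; split=> [w /(_ 0%N)|w Gw i].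
      by rewrite addn0; exact.
    by rewrite leqn0 => /eqP->; rewrite addn0.
  - by rewrite -[X in measurable X]setTI; exact: mZ.
have t0 k : 0 <= k%:R * tau by rewrite mulr_ge0.
pose A' := A `&` Z (m%:R * tau) @^-1` G 0%N.
have FA' : natural_filtration Z (m%:R * tau) A'.
  exact: natural_filtration_preimage.
have mA := natural_filtration_measurable _ _ FA.
have mA' := natural_filtration_measurable _ _ FA'.
have tS : m.+1%:R * tau = m%:R * tau + tau by rewrite -natr1 mulrDl mul1r.
transitivity (\int[P]_(w in A') path_prob K n (fun i => G i.+1) (Z (m.+1%:R * tau) w))%E.
  rewrite -IHn//; last by apply: natural_filtration_le FA'; rewrite tS lerDl.
  congr (P _); apply/seteqP; split=> [w [Aw Gw]|w [[Aw Gw0] Gw]].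
    split; first by split=> //; have := Gw 0%N; rewrite addn0; exact.
    by move=> i ile; have := Gw i.+1 ile; rewrite addnS addSn.
  split=> // -[|i] ile; first by rewrite addn0.
  by rewrite addnS -addSn; exact: Gw.
pose Zm k : {mfun Omega >-> E} :=
  HB.pack (Z (k%:R * tau)) (isMeasurableFun.Build _ _ _ _ _ (mZ _ (t0 k))).
have mp := measurable_path_prob K n (fun i => G i.+1) (fun i => mG i.+1).
have p0 := path_prob_ge0 K n (fun i => G i.+1).
rewrite -(integral_pushforward_mrestr P A' mA' (Zm m.+1))//.
(* The Markov property tested on subevents of the past: restricted to [A'], the law at time [m.+1]
   is the mixture of [K] over the law at time [m]. *)
rewrite (integral_mixture (pushforward (mrestr P mA') (Zm m)) K _ setT)//; last first.
  move=> B mB; rewrite integral_pushforward_mrestr//; last exact: measurable_kernel.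
  change (P (Z (m.+1%:R * tau) @^-1` B `&` A') =
    (\int[P]_(w in A') K (Z (m%:R * tau) w) B)%E).
  by rewrite setIC tS markovZ// kernE.
rewrite integral_pushforward_mrestr//; last 2 first.
- by move=> x; exact: integral_ge0.
- by apply: measurable_fun_integral_kernel => //; exact: measurable_kernel.
rewrite /A' integral_mkcondr; apply: eq_integral => w _ /=.
rewrite epatch_indic /= muleC.
by rewrite !indicE; congr (_ * _)%E.
Qed.

End markov_process_path.

(** Viewing [mu] as a constant kernel from a one-point space reduces the mixture to a composition of
    kernels. *)
Lemma mixture_probability {d1 d2 : measure_display} {T1 : measurableType d1}
    {T2 : measurableType d2} {R : realType} (mu : probability T1 R)
    (k : R.-pker T1 ~> T2) :
  exists n : probability T2 R, forall B, n B = (\int[mu]_x k x B)%E.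
Proof.
pose l : R.-pker unit ~> T1 :=
  kprobability (@measurable_cst _ _ unit (pprobability T1 R) setT mu).
pose m : {measure set T2 -> \bar R} := mkcomp_noparam l k tt.
have m1 : m [set: T2] = 1%E.
  transitivity (\int[l tt]_x (1 : \bar R))%E.
    by apply: eq_integral => x _; exact: prob_kernel.
  rewrite integral_cst// mul1e; exact: (@prob_kernel _ _ _ _ _ l tt).
pose n : probability T2 R :=
  HB.pack (Measure.sort m) (Measure_isProbability.Build _ _ _ m m1).
by exists n.
Qed.

(** * The cocycle, the random periodic path and its orbits *)

Section random_periodic.
Context {d d' : measure_display} {Omega : measurableType d}
  {E : measurableType d'} {R : realType}.
Variables (P : probability Omega R) (theta : R -> Omega -> Omega)
  (Phi : R -> Omega -> E -> E) (tau : R) (Y : R -> Omega -> E).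
Hypotheses (theta_mds : metric_dynamical_system P theta)
  (Phi_cocycle : cocycle P theta Phi)
  (Phi_markov : forall x,
    markov_process P (transition_prob P Phi) (fun t w => Phi t w x))
  (tau_gt0 : 0 < tau)
  (Y_rpp : random_periodic_path P theta Phi tau Y)
  (Y_law : periodic_measure (transition_prob P Phi) tau (law P Y)).

Lemma measurable_cocycle t : 0 <= t ->
  measurable_fun [set: Omega * E] (fun p => Phi t p.1 p.2).
Proof.
move=> t0; have mPhi := cocycle_measurable Phi_cocycle.
have mD : measurable [set p : R * (Omega * E) | 0 <= p.1].
  rewrite (_ : [set _ | _] = fst @^-1` `[0, +oo[%classic); last first.
    by apply/seteqP; split=> p /=; rewrite in_itv/= andbT.
  by rewrite -[X in measurable X]setTI; exact: measurable_fst.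
by apply: (measurable_comp mD _ mPhi (measurable_pair1 t)) => _ [p _ <-].
Qed.

Let cocycle_at : {mfun (Omega * E)%type >-> E} := HB.pack
  (fun p => Phi tau p.1 p.2)
  (isMeasurableFun.Build _ _ _ _ _ (measurable_cocycle tau (ltW tau_gt0))).

(** Convertible to [transition_prob P Phi tau], now carrying the structure of a probability
    kernel. *)
Let K := random_map_kernel P cocycle_at.

Let cocycle_path (p : Omega * E) : @path_space _ E :=
  fun n => Phi (n%:R * tau) p.1 p.2.

Let measurable_cocycle_path : measurable_fun [set: Omega * E] cocycle_path.
Proof.
apply: measurable_into_path_space => n; apply: measurable_cocycle.
by rewrite mulr_ge0// ltW.
Qed.

Let cocycle_path_mfun : {mfun (Omega * E)%type >-> @path_space _ E} :=
  HB.pack cocycle_path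
    (isMeasurableFun.Build _ _ _ _ _ measurable_cocycle_path).

Let Q := random_map_kernel P cocycle_path_mfun.

Let Q_cylinder x n G : (forall i, measurable (G i)) ->
  Q x (cylinder n G) = path_prob K n G x.
Proof.
move=> mG; have mZ t : 0 <= t -> measurable_fun [set: Omega] (fun w => Phi t w x).
  move=> t0; exact: (measurableT_comp (measurable_cocycle t t0) (measurable_pair2 x)).
have := markov_process_path P K (transition_prob P Phi) tau
  (fun t w => Phi t w x) (ltW tau_gt0) erefl mZ (Phi_markov x) n 0 G setT mG.
rewrite setTI mul0r => H; apply: etrans (etrans (H _) _).
- by [].
- by apply: (@measurableT _ (g_sigma_algebraType _)).
rewrite -[RHS]mule1 -(probability_setT P) -integral_cst//.
have mp := measurable_path_prob K n G mG.
apply: ge0_ae_eq_integral => //.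
- by apply: (measurableT_comp mp); exact: mZ.
- by move=> w _; exact: path_prob_ge0.
- by move=> w _; exact: path_prob_ge0.
(* The trajectory starts at [x] only almost surely, since [Phi 0] is the identity only off a null
   set. *)
by apply: filterS (cocycle_property Phi_cocycle) => w [Phi0 _] _; rewrite Phi0.
Qed.

Let mY s : measurable_fun [set: Omega] (Y s).
Proof.
exact: (measurableT_comp (rpp_measurable Y_rpp) (measurable_pair1 s)).
Qed.

Let Y_mfun s : {mfun Omega >-> E} :=
  HB.pack (Y s) (isMeasurableFun.Build _ _ _ _ _ (mY s)).

Let rho s : probability E R := distribution P (Y_mfun s).

Let rhoK s G : measurable G -> (\int[rho s]_x K x G)%E = rho s G.
Proof.
move=> mG; apply: etrans (Y_law.1 s tau G (ltW tau_gt0) mG) _.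
exact: Y_law.2.
Qed.

Let invariant_setsE s G : invariant_sets (transition_prob P Phi) tau (law P Y s) G <->
  measurable G /\ {ae rho s, forall x, K x G = (\1_G x)%:E}.
Proof.
have KE x : measurable G ->
    markov_semigroup (transition_prob P Phi) tau (\1_G) x = K x G.
  move=> mG; apply: etrans (@integral_indic _ _ _ (K x) setT measurableT G mG) _.
  by rewrite setIT.
split=> -[mG KG]; split=> //.
  by apply: (@filterS _ (almost_everywhere (rho s)) _ _ _ _ KG) => x; rewrite KE.
by apply: (@filterS _ (almost_everywhere (rho s)) _ _ _ _ KG) => x; rewrite KE.
Qed.

Definition law_trivial s :=
  forall G, invariant_sets (transition_prob P Phi) tau (law P Y s) G ->
  law P Y s G = 0%E \/ law P Y s G = 1%E.

Lemma ergodic_invariant_lawP s :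
  ergodic_invariant (transition_prob P Phi tau) (law P Y s) <-> law_trivial s.
Proof.
split=> [[Q0 [canQ0 ergQ0]] G /invariant_setsE[mG KG]|triv].
  exact: (ergodic_trivial_invariant_sets K (rho s) (rhoK s) Q0 canQ0 ergQ0).
have [Qmu QmuE] := mixture_probability (rho s) Q.
exists Qmu; split.
  by apply: (mixture_canonical_law K (rho s) Q Q_cylinder) => B _.
apply: (trivial_invariant_sets_ergodic K (rho s) (rhoK s) Q Q_cylinder) => //.
by move=> G mG KG; apply: triv; exact/invariant_setsE.
Qed.

Lemma law_periodic s (k : int) G : measurable G ->
  law P Y (s + k%:~R * tau) G = law P Y s G.
Proof.
move=> mG; have nat_periodic t n : law P Y (t + n%:R * tau) G = law P Y t G.
  elim: n => [|n <-]; first by rewrite mul0r addr0.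
  by rewrite -[in RHS]Y_law.2// -natr1 mulrDl mul1r addrA.
case: k => n; first exact: nat_periodic.
(* [Negz n] stands for [-(n + 1)]: adding [n.+1] periods to the shifted time returns to [s]. *)
by rewrite -[LHS](nat_periodic _ n.+1) NegzE mulrNz mulNr addrNK.
Qed.

(** Bridges the range [[0, tau)] of PS-ergodicity and the arbitrary [s] of the orbit statements; by
    periodicity of the laws, null sets and invariant sets are the same at both times. *)
Lemma law_trivial_period : (forall s, 0 <= s < tau -> law_trivial s) ->
  forall s, law_trivial s.
Proof.
move=> triv s; pose k := - Num.floor (s / tau).
have s0 : 0 <= s + k%:~R * tau < tau.
  rewrite /k mulrNz mulNr subr_ge0 -ler_pdivlMr// floor_le_tmp/=.
  have := floorD1_gt (s / tau).
  by rewrite intrD ltr_pdivrMr// mulrDl mul1r ltrBlDr addrC.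
move=> G [mG [N [mN N0 KN]]]; rewrite -(law_periodic s k)//; apply: triv => //.
split=> //; exists N; split=> //.
by rewrite law_periodic.
Qed.

(** The orbit has countably many points, all with the same law, so almost surely it misses a given
    null set entirely; in the second case that null set is the complement of [G]. *)
Lemma orbit_empty_or_full s G : measurable G ->
  law P Y s G = 0%E \/ law P Y s G = 1%E ->
  {ae P, forall w, periodic_orbit Y tau s w `&` G = set0} \/
  {ae P, forall w, periodic_orbit Y tau s w `<=` G}.
Proof.
have avoid H : measurable H -> law P Y s H = 0%E ->
    {ae P, forall w, forall k : int, ~ H (Y (s + k%:~R * tau) w)}.
  move=> mH H0; have avoid_at (k : int) : {ae P, forall w, ~ H (Y (s + k%:~R * tau) w)}.
    exists (Y (s + k%:~R * tau) @^-1` H); split.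
    - by rewrite -[X in measurable X]setTI; exact: mY.
    - by rewrite -[RHS]H0 -(law_periodic s k).
    - by move=> w /=; exact: contrapT.
  have := ae_foralln (fun n => avoid_at (Posz n)).
  apply: filterS2 (ae_foralln (fun n => avoid_at (Negz n))) => w neg pos.
  by case.
move=> mG [G0|G1]; [left|right].
  apply: filterS (avoid G mG G0) => w wG.
  by apply/seteqP; split=> // _ [[k _ <-]] /wG.
have mCG := measurableC mG; have CG0 : law P Y s (~` G) = 0%E.
  have := @probability_setC _ _ _ (rho s) G mG.
  by rewrite [X in (1 - X)%E]G1 subee.
apply: filterS (avoid _ mCG CG0) => w wG _ [k _ <-].
exact: contrapT (wG k).
Qed.

(** Two orbit points suffice: [Y s w] and [Y (s + tau) w = Y s (theta tau w)] lie in [G] together or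
    not at all, so the event that [Y s] is in [G] is almost invariant. *)
Lemma orbit_zero_one s G : ergodic P (theta tau) -> measurable G ->
  {ae P, forall w, periodic_orbit Y tau s w `&` G = set0 \/
                   periodic_orbit Y tau s w `<=` G} ->
  law P Y s G = 0%E \/ law P Y s G = 1%E.
Proof.
move=> ergP mG orbitG.
apply: (@ergodic_ae _ _ _ P (theta tau) (Y s @^-1` G)) => //.
- exact: (measurableT_comp (theta_measurable theta_mds) (measurable_pair1 tau)).
- exact: theta_preserves.
- by rewrite -[X in measurable X]setTI; exact: mY.
have [_] := Y_rpp; apply: filterS2 orbitG => w + [_ Ytheta].
have Ys : periodic_orbit Y tau s w (Y s w).
  by exists 0 => //; rewrite mul0r addr0.
have Ystau : periodic_orbit Y tau s w (Y s (theta tau w)).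
  by exists 1 => //; rewrite mul1r Ytheta.
case=> [YG0|YG]; last by split=> _ /=; exact: YG.
have notG y : periodic_orbit Y tau s w y -> ~ G y.
  by move=> Oy Gy; have : (periodic_orbit Y tau s w `&` G) y by []; rewrite YG0.
by split=> Gy; [case: (notG _ Ys)|case: (notG _ Ystau)].
Qed.

End random_periodic.

Theorem corollary3p8 (R : realType) (d : measure_display)
    (Omega : measurableType d) (P : probability Omega R)
    (theta : R -> Omega -> Omega) (F : R -> R -> set (set Omega))
    (X : ptopologicalType) (Phi : R -> Omega -> borel X -> borel X)
    (tau : R) (Y : R -> Omega -> borel X)
    (polishX : polish R X)
    (fds : filtered_dynamical_system P theta F)
    (markovian : markovian_cocycle P theta F Phi)
    (tau_gt0 : 0 < tau)
    (rpp : random_periodic_path P theta Phi tau Y)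
    (adaptedY : adapted F Y)
    (periodic : periodic_measure (transition_prob P Phi) tau (law P Y))
    (ergodic_theta : ergodic P (theta tau)) :
  let a := forall s (G : set (borel X)),
    invariant_sets (transition_prob P Phi) tau (law P Y s) G ->
    {ae P, forall w, periodic_orbit Y tau s w `&` G = set0 \/ periodic_orbit Y tau s w `<=` G} in
  let b := PS_ergodic (transition_prob P Phi) tau (law P Y) in
  let c := forall s (G : set (borel X)),
    invariant_sets (transition_prob P Phi) tau (law P Y s) G ->
    {ae P, forall w, periodic_orbit Y tau s w `&` G = set0} \/
    {ae P, forall w, periodic_orbit Y tau s w `<=` G} in
  (a <-> b) /\ (a <-> c).
Proof.
move=> a b c.
have mds := fds_metric fds.
have cocyc := mc_cocycle markovian; have markov := mc_markov markovian.
have lawP s := ergodic_invariant_lawP P theta Phi tau Y cocyc markov tau_gt0 rpp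
  periodic s.
(* The equivalences follow from the cycle [a], [b], [c], [a]; ergodicity of [theta tau] enters at
   this first implication. *)
have ab : a -> b.
  move=> ha s _; apply: (lawP s).2 => G GI.
  apply: (orbit_zero_one P theta Phi tau Y mds rpp s G ergodic_theta); last exact: ha.
  by case: GI.
have bc : b -> c.
  move=> hb s G GI.
  apply: (orbit_empty_or_full P theta Phi tau Y rpp periodic) => //; first by case: GI.
  apply: (law_trivial_period P Phi tau Y tau_gt0 periodic) GI => t /hb; exact: (lawP t).1.
have ca : c -> a.
  by move=> hc s G /hc[]; apply: filterS => w; [left|right].
by split; split=> // h; [exact/ca/bc|exact/bc/ab].
Qed.
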